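(* Let $A$ be a uniform algebra and let $(x_n)_{n\ge1}$ be a sequence in $M_A$. For each $n$ put $\delta_n:=\prod_{k\neq n}\rho_A(x_n,x_k)$. If $\sum_{n=1}^\infty(1-\delta_n)^{1/3}<\infty$, then $(x_n)_n$ is interpolating for $A^{**}$, i.e. for every bounded sequence of complex numbers $(\alpha_n)_n$ there exists $F\in A^{**}$ such that $F(x_n)=\alpha_n$ for every $n$.
   Context: A uniform algebra $A$ is a unital commutative Banach algebra whose norm satisfies $\|f^2\|=\|f\|^2$ (equivalently, a closed unital point-separating subalgebra of some $C(K)$, $K$ compact Hausdorff, with the sup norm). $M_A\subset A^*$ denotes its maximal ideal space (the nonzero multiplicative linear functionals), and $f(x):=x(f)$ for $x\in M_A$, $f\in A$. The bidual $A^{**}$ is a uniform algebra with the Arens product; each $x\in M_A\subset A^*$ acts on $F\in A^{**}$ by $F(x)$ (the usual duality pairing), and this makes $x$ a character of $A^{**}$. The Gleason distance on $M_A$ is $$\rho_A(x,y):=\sup\{|f(x)|: f\in A,\ \|f\|\le 1,\ f(y)=0\}.$$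
   Formalization: The points x_n are assumed pairwise distinct; with a repeated point the claim fails (e.g. A = C(K), x_1 = x_2, all other points distinct: the sum is 2, but F(x_1) = F(x_2) for every F). *)

(* Defs.v *)
From HB Require Import structures.
From mathcomp Require Import all_boot all_order all_algebra.
From mathcomp Require Import complex.
From mathcomp Require Import all_classical all_reals all_analysis.

Set Implicit Arguments.
Unset Strict Implicit.
Unset Printing Implicit Defensive.

Import Order.TTheory GRing.Theory Num.Theory.
Import numFieldNormedType.Exports.
Import ComplexField.Normc.

Local Open Scope classical_set_scope.
Local Open Scope ring_scope.
Local Open Scope complex_scope.

(* The product is carried by the mixin, not by GRing.ComAlgebra: HB has no
   structure joining the algebraic hierarchy with normed modules other than
   number domains, and such a join can no longer be declared downstream. *)
HB.mixin Record isUniformAlgebra (R : realType) A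
    & CompleteNormedModule R[i] A := {
  uone : A ;
  umul : A -> A -> A ;
  umulA : associative umul ;
  umulC : commutative umul ;
  umul1 : left_id uone umul ;
  umulDl : left_distributive umul +%R ;
  uscaleAl : forall (c : R[i]) (f g : A), c *: umul f g = umul (c *: f) g ;
  unorm_mul_le : forall f g : A, `|umul f g| <= `|f| * `|g| ;
  unorm_sqr : forall f : A, `|umul f f| = `|f| ^+ 2
}.

#[short(type="uniformAlgebraType")]
HB.structure Definition UniformAlgebra (R : realType) :=
  {A of CompleteNormedModule R[i] A & isUniformAlgebra R A}.

Section Dual.
Context {R : realType} (E : normedModType R[i]).

Definition dual_pred : {pred E -> R[i]^o} :=
  fun phi => `[< linear phi /\ continuous phi >].

Record dual := Dual { dual_val :> E -> R[i]^o; _ : dual_val \in dual_pred }.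

HB.instance Definition _ := [isSub for dual_val].
HB.instance Definition _ := [Choice of dual by <:].

Lemma dual_predP (phi : E -> R[i]^o) :
  reflect (linear phi /\ continuous phi) (phi \in dual_pred).
Proof. exact: asboolP. Qed.

Lemma dual_submod_closed : submod_closed dual_pred.
Proof.
split.
  apply/dual_predP; split; last exact: cst_continuous.
  by move=> c f g; rewrite /GRing.zero /= scaler0 addr0.
move=> c phi psi /dual_predP[lphi cphi] /dual_predP[lpsi cpsi].
apply/dual_predP; split.
  move=> d f g; have cphiE h : (c *: phi + psi) h = c *: phi h + psi h by [].
  by rewrite !cphiE lphi lpsi !scalerDr addrACA !scalerA (mulrC c d).
move=> f; apply: cvgD; last exact: cpsi.
by apply: cvgZr; exact: cphi.
Qed.

HB.instance Definition _ :=
  GRing.isSubmodClosed.Build R[i] (E -> R[i]^o) dual_pred dual_submod_closed.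
HB.instance Definition _ := [SubChoice_isSubLmodule of dual by <:].

Lemma dual_linear (phi : dual) : linear phi.
Proof. by case: phi => phi /= /dual_predP[]. Qed.

Lemma dual_continuous (phi : dual) : continuous phi.
Proof. by case: phi => phi /= /dual_predP[]. Qed.

HB.instance Definition _ (phi : dual) :=
  GRing.isLinear.Build R[i] E R[i]^o *:%R (dual_val phi) (dual_linear phi).

Definition dual_norm (phi : dual) : R[i] :=
  (sup [set normc (phi f) | f in [set f : E | `|f| <= 1]])%:C.

Lemma dual_has_sup (phi : dual) :
  has_sup [set normc (phi f) | f in [set f : E | `|f| <= 1]].
Proof.
split; first by exists (normc (phi 0)), 0 => //=; rewrite normr0.
have /linear_boundedP : bounded_near phi (nbhs (0 : E)).
  by apply: continuous_linear_bounded; exact: dual_continuous.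
move=> /pinfty_ex_gt0[M M0 Mphi].
exists (complex.Re M) => _ /= [f f1 <-].
have MR : M = (complex.Re M)%:C by rewrite RRe_real// gtr0_real.
rewrite -lecR -MR (le_trans (Mphi f))//.
by rewrite -[leRHS]mulr1 ler_pM2l.
Qed.

Lemma dual_norm_ub (phi : dual) (f : E) :
  `|f| <= 1 -> `|phi f| <= dual_norm phi.
Proof.
move=> f1; rewrite /dual_norm lecR; apply: ub_le_sup.
  by have [] := dual_has_sup phi.
by exists f.
Qed.

Lemma dual_norm_lub (phi : dual) (M : R) :
  (forall f : E, `|f| <= 1 -> `|phi f| <= M%:C) -> dual_norm phi <= M%:C.
Proof.
move=> Mphi; rewrite /dual_norm lecR; apply: ge_sup.
  by have [] := dual_has_sup phi.
by move=> _ [f f1 <-]; have := Mphi f f1; rewrite lecR.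
Qed.

Lemma dual_normD (phi psi : dual) :
  dual_norm (phi + psi) <= dual_norm phi + dual_norm psi.
Proof.
rewrite [leRHS](_ : _ = (complex.Re (dual_norm phi) + complex.Re (dual_norm psi))%:C);
  last by rewrite /dual_norm/= -rmorphD.
apply: dual_norm_lub => f f1.
apply: (le_trans (ler_normD (phi f) (psi f))).
by rewrite rmorphD/=; apply: lerD; exact: dual_norm_ub.
Qed.

Lemma dual_normZ_le (c : R[i]) (phi : dual) :
  dual_norm (c *: phi) <= `|c| * dual_norm phi.
Proof.
rewrite [leRHS](_ : _ = (normc c * complex.Re (dual_norm phi))%:C);
  last by rewrite /dual_norm/= rmorphM.
apply: dual_norm_lub => f f1.
have -> : (c *: phi) f = c * phi f by [].
by rewrite normrM rmorphM/= ler_wpM2l//; exact: dual_norm_ub.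
Qed.

Lemma dual_normZ (c : R[i]) (phi : dual) :
  dual_norm (c *: phi) = `|c| * dual_norm phi.
Proof.
have [->|c0] := eqVneq c 0.
  rewrite normr0 mul0r scale0r; apply/le_anti/andP; split.
    by apply: dual_norm_lub => f f1; rewrite normr0.
  have := @dual_norm_ub 0 0; rewrite normr0 => /(_ ler01).
  by apply: le_trans.
apply/le_anti; rewrite dual_normZ_le/=.
rewrite -ler_pdivlMl ?normr_gt0// -normfV.
by rewrite -[X in dual_norm X <= _](scalerK c0) dual_normZ_le.
Qed.

Lemma dual_norm0_eq0 (phi : dual) : dual_norm phi = 0 -> phi = 0.
Proof.
move=> phi0; apply/val_inj/funext => f /=.
have [->|f0] := eqVneq f 0; first by rewrite linear0.
have nf0 : `|f| != 0 by rewrite normr_eq0.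
have /dual_norm_ub : `| `|f|^-1 *: f | <= 1.
  by rewrite normrZ normfV normr_id mulVf.
move=> /(_ phi); rewrite phi0 normr_le0 linearZ /= scaler_eq0 invr_eq0.
by rewrite (negbTE nf0)/= => /eqP.
Qed.

HB.instance Definition _ := @Lmodule_isNormed.Build R[i] dual dual_norm
  dual_normD dual_normZ dual_norm0_eq0.

Lemma dual_normE (phi : dual) : `|phi| = dual_norm phi.
Proof. by []. Qed.

End Dual.

Definition bidual {R : realType} (E : normedModType R[i]) := dual (dual E).

Section Interpolation.
Context {R : realType} {A : uniformAlgebraType R}.
Implicit Types x : nat -> dual A.

Definition maximal_ideal_space : set (dual A) :=
  [set x : dual A | x != 0 /\ forall f g : A, x (umul f g) = x f * x g].

Definition gleason (x y : dual A) : R :=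
  sup [set normc (x f) | f in [set f : A | `|f| <= 1 /\ y f = 0]].

(* The factors lie in [0, 1], so the partial products always converge. *)
Definition delta x (n : nat) : R :=
  limn (fun N => \prod_(0 <= k < N | k != n) gleason (x n) (x k)).

Definition interpolating_bidual x :=
  forall alpha : nat -> R[i]^o, bounded_fun alpha ->
    exists F : bidual A, forall n, F (x n) = alpha n.

End Interpolation.
Arguments maximal_ideal_space {R} A.

(* Main.v *)
(* Fix N. Below [delta n] one finds f_n in the unit ball of A with
   f_n(x_n) = t_n := 1 - e_n and f_n(x_k) = 0 for the other k < N, where the e_n
   have a finite sum. Put b = e / (1 - (1 - e) z) on the disc and
   q = 1 - b, p = z b^2 / 2. Then |p| + |q| <= 1, p(0) = 0, q(0) = 1 - e, and
   p(t) is bounded below. Hence the recursion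
     T_(n+1) = beta_n p_n(f_n) + q_n(f_n) T_n / (1 - e_n)
   prescribes the value at x_n without changing the values at the other points,
   and multiplies the norm by at most 1 + O(e_n). Finitely many points with a
   small [delta n] are treated separately, with fixed separating functions
   multiplied by 1 - T, where T is 1 at the good points and 0 at the bad ones.
   The interpolation constant does not depend on N, and a limit along an
   ultrafilter of the functionals phi |-> phi (T_N) is the required F.

   Norm estimates on A come from ||f^2|| = ||f||^2 through large powers, so that
   no Gelfand representation is needed; they apply to polynomials, whence the
   truncation of b. *)
Require Import Defs.
From HB Require Import structures.
From mathcomp Require Import all_boot all_order all_algebra.
From mathcomp Require Import cyclic separable cyclotomic complex.
From mathcomp Require Import all_classical all_reals all_analysis.
From mathcomp Require Import zify ring lra.

Import Order.TTheory GRing.Theory Num.Theory.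
Import numFieldNormedType.Exports.

Local Open Scope classical_set_scope.
Local Open Scope ring_scope.

(** * Coefficient bounds through roots of unity, and comparison of large powers *)

Lemma closed_prim_root_exists (C : numClosedFieldType) (n : nat) :
  (0 < n)%N -> exists z : C, n.-primitive_root z.
Proof.
move=> n_gt0; pose p : {poly C} := 'X^n - 1.
have [r Dp] := closed_field_poly_normal p.
rewrite (monicP _) ?monicXnsubC // scale1r in Dp.
have rn1 : all n.-unity_root r by apply/allP => z; rewrite -root_prod_XsubC -Dp.
have sz_r : (n <= size r)%N.
  by rewrite -ltnS -(size_prod_XsubC r id) -Dp size_XnsubC.
have [|z _ z_prim] := hasP (has_prim_root n_gt0 rn1 _ sz_r); last by exists z.
by rewrite -separable_prod_XsubC -Dp separable_Xn_sub_1 // pnatr_eq0 -lt0n.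
Qed.

(* Averages [p.[w] * w ^- k] over the roots of unity [w] of large order. *)
Lemma norm_coef_le (C : numClosedFieldType) (p : {poly C}) (M : C) (k : nat) :
  (forall z : C, `|z| = 1 -> `|p.[z]| <= M) -> `|p`_k| <= M.
Proof.
move=> pM; set n := maxn (size p) k.+1.
have n_gt0 : (0 < n)%N by rewrite leq_max orbT.
have [w w_prim] := closed_prim_root_exists C n n_gt0.
have wn : w ^+ n = 1 by exact: prim_expr_order.
have nw : `|w| = 1.
  by apply/eqP; rewrite -(@pexpr_eq1 _ _ n)// -normrX wn normr1.
have w0 : w != 0 by rewrite -normr_eq0 nw oner_eq0.
have kn : (k < n)%N by rewrite leq_max leqnn orbT.
have E : \sum_(j < n) p.[w ^+ j] * (w ^+ k) ^- j = p`_k *+ n.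
  have wE i j : (w ^+ j) ^+ i * (w ^+ k) ^- j = (w ^+ i / w ^+ k) ^+ j.
    by rewrite expr_div_n -!exprM mulnC.
  under eq_bigr => j _.
    rewrite (@horner_coef_wide _ n) ?leq_maxl// mulr_suml.
    under eq_bigr => i _ do rewrite -mulrA wE.
    over.
  rewrite exchange_big /= (bigD1 (Ordinal kn)) //= [X in _ + X]big1 ?addr0.
    under eq_bigr => j _ do
      rewrite mulfV ?expf_neq0// expr1n mulr1.
    by rewrite sumr_const card_ord.
  (* For [i != k] below [n], [u] is an [n]-th root of unity other than 1, so its geometric sum
     vanishes. *)
  move=> i ik; rewrite -mulr_sumr; set u := w ^+ i / w ^+ k.
  have u1 : u - 1 != 0.
    rewrite subr_eq0; apply: contraNneq ik => u1.
    have /eqP : w ^+ i = w ^+ k.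
      by rewrite -[LHS](divfK (expf_neq0 k w0)) -/u u1 mul1r.
    by rewrite (eq_prim_root_expr w_prim) !modn_small.
  have : (u - 1) * \sum_(j < n) u ^+ j = 0.
    by rewrite -subrX1 /u exprMn exprVn -!exprM !(mulnC _ n) !exprM wn
         !expr1n divr1 subrr.
  by move=> /eqP; rewrite mulf_eq0 (negbTE u1)/= => /eqP ->; rewrite mulr0.
rewrite -(@ler_pMn2r _ n)// -normrMn -E.
apply: (le_trans (ler_norm_sum _ _ _)).
rewrite -[X in _ <= _ *+ X]card_ord -sumr_const; apply: ler_sum => j _.
by rewrite normrM normrV ?unitfE ?expf_neq0// !normrX nw !expr1n invr1 mulr1
  pM// normrX nw expr1n.
Qed.

(** If [s = (1 + a) M] with [a > 0], then [(1 + a) ^+ (2 ^ k)] outgrows [K * 4 ^+ k]. With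
    [m = 2 ^ k] the tolerated loss is [K m^2], polynomial in the exponent. *)
Lemma le_of_powers_le (R : realType) (s M K : R) : 0 <= s -> 0 <= M ->
  (forall k, s ^+ (2 ^ k) <= K * 4 ^+ k * M ^+ (2 ^ k)) -> s <= M.
Proof.
move=> s0 M0 sM; rewrite leNgt; apply/negP => Ms.
have [M00|M00] := eqVneq M 0.
  by have := sM 0%N; rewrite M00 expn0 !expr1 mulr0 leNgt -M00 Ms.
have Mgt0 : 0 < M by rewrite lt0r M00.
pose a := s / M - 1.
have a0 : 0 < a by rewrite subr_gt0 ltr_pdivlMr ?mul1r.
have sa k : (1 + a) ^+ (2 ^ k) <= K * 4 ^+ k.
  by rewrite /a addrC subrK expr_div_n ler_pdivrMr ?exprn_gt0.
have lin n : a * n%:R <= (1 + a) ^+ n.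
  suff: 1 + a * n%:R <= (1 + a) ^+ n by apply: le_trans; rewrite lerDr.
  elim: n => [|n IH]; first by rewrite mulr0 addr0 expr0.
  rewrite exprS -natr1; apply: (@le_trans _ _ ((1 + a) * (1 + a * n%:R))).
    by have := mulr_ge0 (sqr_ge0 a) (ler0n R n); nra.
  by rewrite ler_wpM2l// addr_ge0// ltW.
(* Bernoulli's inequality at exponent [2 ^ k], raised to the fourth power, gives
   [16^k a^4 <= K 4^(k+2)]; dividing by [4^k] and using [k <= 4^k] leaves a bound on all [k],
   against the Archimedean property. *)
have bnd k : k%:R * a ^+ 4 <= 16 * K.
  have h1 : (a * (2 ^ k)%:R) ^+ 4 <= K * 4 ^+ k.+2.
    apply: le_trans (sa k.+2).
    have -> : (2 ^ k.+2 = 2 ^ k * 4)%N by rewrite !expnS mulnA mulnC.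
    rewrite exprM; apply: lerXn2r; rewrite ?nnegrE.
    - exact: mulr_ge0 (ltW a0) (ler0n _ _).
    - by rewrite exprn_ge0// addr_ge0// ltW.
    - exact: lin.
  have h2 : 4 ^+ k * a ^+ 4 <= 16 * K.
    have E : (2 ^ k)%:R ^+ 4 = 4 ^+ k * 4 ^+ k :> R.
      by rewrite natrX -!exprM mulnC exprM -exprMn; congr (_ ^+ _); ring.
    rewrite -(@ler_pM2l _ (4 ^+ k)) ?exprn_gt0//.
    rewrite exprMn E !exprS in h1.
    by apply: le_trans (le_trans h1 _); rewrite le_eqVlt; apply/orP; left;
      apply/eqP; ring.
  apply: le_trans h2; rewrite ler_pM2r ?exprn_gt0//.
  by rewrite -natrX ler_nat ltnW// ltn_expl.
have K0 : 0 <= 16 * K.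
  by have := bnd 0%N; rewrite mul0r.
have := bnd (Num.truncn (16 * K / a ^+ 4)).+1.
by rewrite leNgt -ltr_pdivrMr ?exprn_gt0// truncnS_gt.
Qed.

(** * Norms of polynomials in elements of a uniform algebra *)

Section UniformAlgebraTheory.
Context {R : realType} {A : uniformAlgebraType R} (nz : (uone : A) != 0).

(* The carrier [A] with its product as a MathComp algebra; [nz] is an argument
   because MathComp algebras are nontrivial. *)
Definition ualg of (uone : A) != 0 : Type := A.
Local Notation B := (ualg nz).

HB.instance Definition _ := CompleteNormedModule.on B.

HB.instance Definition _ := GRing.Zmodule_isComNzRing.Build B
  (@umulA R A) (@umulC R A) (@umul1 R A) (@umulDl R A) nz.
HB.instance Definition _ :=
  GRing.Lmodule_isLalgebra.Build R[i] B (@uscaleAl R A).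
HB.instance Definition _ := GRing.Lalgebra_isComAlgebra.Build R[i] B.

Local Open Scope complex_scope.

Lemma ualg_normM (f g : B) : `|f * g| <= `|f| * `|g|.
Proof. exact: unorm_mul_le. Qed.

Lemma ualg_norm_exp2 (f : B) k : `|f ^+ (2 ^ k)| = `|f| ^+ (2 ^ k).
Proof.
elim: k => [|k IH]; first by rewrite !expr1.
rewrite expnS mulnC !exprM -IH; exact: (unorm_sqr (f ^+ (2 ^ k) : A)).
Qed.

Lemma ualg_norm1 : `|1 : B| = 1.
Proof.
have /eqP := ualg_norm_exp2 1 1.
rewrite expr1n eq_sym expn1 expr2 -subr_eq0 -[X in _ - X]mulr1 -mulrBr mulf_eq0.
by rewrite normr_eq0 oner_eq0/= subr_eq0 => /eqP.
Qed.

Lemma ualg_normX_le1 (f : B) n : `|f| <= 1 -> `|f ^+ n| <= 1.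
Proof.
move=> f1; elim: n => [|n IH]; first by rewrite expr0 ualg_norm1.
by rewrite exprS (le_trans (ualg_normM _ _))// mulr_ile1.
Qed.

(** Each coefficient is at most [M] by [norm_coef_le]. The factor [size p] lost here disappears
    later, when high powers are compared. *)
Lemma norm_horner_alg_le (f : B) (p : {poly R[i]}) (M : R[i]) : `|f| <= 1 ->
  (forall z, `|z| <= 1 -> `|p.[z]| <= M) ->
  `|horner_alg f p| <= (size p)%:R * M.
Proof.
move=> f1 pM; rewrite -[p in horner_alg f p]coefK poly_def linear_sum /=.
apply: le_trans (ler_norm_sum _ _ _) _.
rewrite mulr_natl -[X in _ <= _ *+ X]card_ord -sumr_const.
apply: ler_sum => i _; rewrite linearZ rmorphXn /= horner_algX mulr_algl normrZ.
rewrite -[leRHS]mulr1 ler_pM ?ualg_normX_le1//.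
by apply: norm_coef_le => z z1; apply: pM; rewrite z1.
Qed.

(* A two-variable von Neumann inequality. Comparing [m]-th powers, the trivial
   bound by coefficients only costs a factor polynomial in [m]. *)
Lemma norm_horner_alg2_le (f u g : B) (p q : {poly R[i]}) (M : R) :
    `|f| <= 1 -> `|u| <= 1 -> `|g| <= 1 ->
    (forall z, `|z| <= 1 -> `|p.[z]| + `|q.[z]| <= M%:C) ->
  `|horner_alg f p * u + horner_alg f q * g| <= M%:C.
Proof.
move=> f1 u1 g1 pqM; set T := _ + _.
have M0 : 0 <= M.
  by rewrite -lecR (le_trans _ (pqM 0 _)) ?normr0// addr_ge0.
have TM m : `|T ^+ m| <= (m.+1 * (m * (size p + size q)).+1)%:R * M%:C ^+ m.
  rewrite /T exprDn natrM -mulrA mulr_natl.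
  rewrite -[X in _ <= _ *+ X]card_ord -sumr_const.
  apply: le_trans (ler_norm_sum _ _ _) _; apply: ler_sum => j _.
  have jm : (j <= m)%N by rewrite -ltnS.
  pose P := p ^+ (m - j) * q ^+ j *+ 'C(m, j).
  have -> : (horner_alg f p * u) ^+ (m - j) *
      (horner_alg f q * g) ^+ j *+ 'C(m, j) =
      horner_alg f P * (u ^+ (m - j) * g ^+ j).
    by rewrite /P rmorphMn/= rmorphM !rmorphXn/= !exprMn mulrnAl mulrACA.
  apply: le_trans (ualg_normM _ _) _.
  rewrite -[leRHS]mulr1 ler_pM//; last first.
    apply: le_trans (ualg_normM _ _) _.
    by rewrite mulr_ile1// ualg_normX_le1.
  (* [|P.[z]|] is a single term of the binomial expansion of [(|p.[z]| + |q.[z]|) ^+ m], whose terms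
     are all nonnegative. *)
  have PM z : `|z| <= 1 -> `|P.[z]| <= M%:C ^+ m.
    move=> z1; have pqz := pqM z z1.
    have : (`|p.[z]| + `|q.[z]|) ^+ m <= M%:C ^+ m.
      by rewrite lerXn2r ?nnegrE ?addr_ge0// ler0c.
    apply: le_trans; rewrite exprDn (bigD1 (Ordinal (ltn_ord j))) //=.
    rewrite /P hornerMn hornerM !horner_exp normrMn normrM !normrX.
    by rewrite lerDl sumr_ge0.
  apply: le_trans (norm_horner_alg_le f P _ f1 PM) _.
  rewrite ler_wpM2r ?exprn_ge0 ?ler0c// ler_nat.
  rewrite /P -scaler_nat (leq_trans (size_scale_leq _ _))//.
  apply: leq_trans (size_polyMleq _ _) _.
  have := leq_add (size_poly_exp_leq p (m - j)) (size_poly_exp_leq q j).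
  set a := size (p ^+ _); set b := size (q ^+ _).
  have : ((size p).-1 * (m - j) <= size p * m)%N.
    by rewrite leq_mul ?leq_pred ?leq_subr.
  have : ((size q).-1 * j <= size q * m)%N by rewrite leq_mul ?leq_pred.
  rewrite mulnDr (mulnC m) (mulnC m); lia.
have TR : `|T| = (complex.Re `|T|)%:C by rewrite RRe_real// ger0_real.
rewrite TR lecR.
(* With [m = 2 ^ k] and [d = size p + size q], [(m + 1) (m d + 1) <= 2 (d + 1) m^2], and
   [m^2 = 4 ^ k]. *)
apply: (le_of_powers_le _ _ _ (2 * (size p + size q).+1)%:R) => //.
  by rewrite -ler0c -TR.
move=> k; rewrite -lecR rmorphXn/= -TR -ualg_norm_exp2.
apply: le_trans (TM _) _; set m := (2 ^ k)%N; set d := (size p + size q)%N.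
have -> N : N%:R * M%:C ^+ m = (N%:R * M ^+ m)%:C.
  by rewrite rmorphM rmorphXn/= rmorph_nat.
rewrite lecR ler_wpM2r ?exprn_ge0// -natrX -natrM ler_nat.
have m0 : (0 < m)%N by rewrite expn_gt0.
have -> : (4 ^ k = m * m)%N by rewrite -expnMn.
by nia.
Qed.
End UniformAlgebraTheory.

(** * A pair of polynomials on the closed unit disc *)

Section DiscFunctions.
Context {R : realType}.
Local Open Scope complex_scope.
Import ComplexField.Normc.

Lemma normc_ge0 (z : R[i]) : 0 <= normc z.
Proof. by case: z => a b; exact: sqrtr_ge0. Qed.

Lemma Re_le_normc (z : R[i]) : complex.Re z <= normc z.
Proof.
case: z => a b /=; rewrite (le_trans (ler_norm _))//.
by rewrite -sqrtr_sqr ler_wsqrtr// lerDl sqr_ge0.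
Qed.

(* AM-GM: [|w - e| |w| <= (|w - e|^2 + |w|^2) / 2]. *)
Lemma normc_sub_inv_le (e : R) (w : R[i]) : 0 < e -> e <= complex.Re w ->
  normc (1 - e%:C / w) + normc (e%:C / w) ^+ 2 / 2 <= 1.
Proof.
move=> e0 ew; have n0 : 0 < normc w.
  exact: lt_le_trans e0 (le_trans ew (Re_le_normc _)).
have w0 : w != 0 by apply: contraTneq n0 => ->; rewrite normc0 ltxx.
have -> : 1 - e%:C / w = (w - e%:C) / w by rewrite mulrBl divff.
rewrite !normcM normcV.
have -> : normc e%:C = e by rewrite /= expr0n addr0 sqrtr_sqr gtr0_norm.
have nE : normc w ^+ 2 = complex.Re w ^+ 2 + complex.Im w ^+ 2.
  by case: (w) => a b /=; rewrite sqr_sqrtr// addr_ge0 ?sqr_ge0.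
have mE : normc (w - e%:C) ^+ 2 = (complex.Re w - e) ^+ 2 + complex.Im w ^+ 2.
  by case: (w) => a b /=; rewrite oppr0 addr0 sqr_sqrtr// addr_ge0 ?sqr_ge0.
move: (normc w) (normc (w - _)) n0 nE mE => n m n0 nE mE.
rewrite exprMn exprVn -mulrA -(@ler_pM2r _ (n ^+ 2)) ?exprn_gt0// mul1r.
rewrite [leLHS](_ : _ = m * n + e ^+ 2 / 2); last by field; rewrite gt_eqF.
by have := sqr_ge0 (m - n); nra.
Qed.

(* With [b = e / (1 - (1 - e) z)], a map of the unit disc into itself, the pair
   is a truncation of [(z b^2 / 2, 1 - b)]. *)
Lemma exists_splitting_polys (e : R) : 0 < e -> e <= 2^-1 ->
  exists p q : {poly R[i]}, [/\
    forall z, `|z| <= 1 -> `|p.[z]| + `|q.[z]| <= (1 + e)%:C,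
    p.[0] = 0, q.[0] = (1 - e)%:C &
    exists2 c : R, 64^-1 <= c & p.[(1 - e)%:C] = c%:C].
Proof.
move=> e0 e1; pose r := 1 - e.
have r0 : 0 < r by rewrite /r; lra.
have r1 : r < 1 by rewrite /r; lra.
(* [L] is the truncation order: cutting the geometric series of [1 / (1 - r z)] after [L] terms
   multiplies [b] by [1 - Q], where [Q = (r z)^L] has modulus at most [e / 4]. *)
have [L rL] : exists L, r ^+ L <= e / 4.
  have : r ^+ n @[n --> \oo] --> (0 : R) by apply: cvg_expr; rewrite gtr0_norm.
  move=> /cvgr0_norm_le /(_ (e / 4)) []; first by rewrite divr_gt0.
  move=> N _ /(_ N (leqnn _)) /= H.
  by exists N; rewrite (le_trans (ler_norm _)).
have L0 : (0 < L)%N.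
  by case: L rL => //; rewrite expr0; lra.
pose h : {poly R[i]} := \poly_(k < L) (r ^+ k)%:C.
have hE z : h.[z] = \sum_(k < L) (r%:C * z) ^+ k.
  by rewrite horner_poly; apply: eq_bigr => k _; rewrite exprMn rmorphXn.
have hM z : (1 - r%:C * z) * h.[z] = 1 - (r%:C * z) ^+ L.
  by rewrite hE -opprB mulNr -subrX1 opprB.
have h0 : h.[0] = 1.
  by rewrite horner_coef0 coef_poly L0 expr0.
pose p := 2^-1 *: ('X * (e%:C *: h) ^+ 2); pose q := 1 - e%:C *: h.
have pE z : p.[z] = 2^-1 * (z * (e%:C * h.[z]) ^+ 2).
  by rewrite !hornerE.
have qE z : q.[z] = 1 - e%:C * h.[z] by rewrite !hornerE.
exists p, q; split.
- move=> z z1; set w := 1 - r%:C * z; set Q := (r%:C * z) ^+ L.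
  have z1' : normc z <= 1 by rewrite -lecR.
  have nrz : normc (r%:C * z) <= r.
    rewrite normcM -[leRHS]mulr1 /= expr0n addr0 sqrtr_sqr gtr0_norm//.
    by rewrite ler_pM2l.
  have ew : e <= complex.Re w.
    have -> : complex.Re w = 1 - complex.Re (r%:C * z).
      by rewrite /w; case: (_ * _).
    by have := le_trans (Re_le_normc _) nrz; rewrite /r; lra.
  have w0 : w != 0 by apply: contraTneq ew => ->; rewrite -ltNge.
  have Q_le : normc Q <= e / 4.
    have -> : normc Q = normc (r%:C * z) ^+ L.
      by apply: complexI; rewrite rmorphXn /= -[RHS]normrX.
    by rewrite (le_trans _ rL)// lerXn2r ?nnegrE ?normc_ge0// ltW.
  have ehE : e%:C * h.[z] = e%:C / w * (1 - Q).
    by rewrite -(hM z) -/w mulrA divfK.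
  have := normc_sub_inv_le e w e0 ew; rewrite pE qE ehE.
  set b := e%:C / w => bW.
  have b2 : normc b <= 3 / 2.
    have : 0 <= normc (1 - b) by exact: normc_ge0.
    by have := normc_ge0 b; nra.
  rewrite [leLHS](_ : _ = (normc (2^-1 * (z * (b * (1 - Q)) ^+ 2)) +
    normc (1 - b * (1 - Q)))%:C); last by rewrite rmorphD.
  rewrite lecR.
  have q_le : normc (1 - b * (1 - Q)) <= normc (1 - b) + normc b * normc Q.
    rewrite -normcM (le_trans _ (le_normcD _ _))// le_eqVlt; apply/orP; left.
    by apply/eqP; congr normc; ring.
  have p_le : normc (2^-1 * (z * (b * (1 - Q)) ^+ 2)) <=
      2^-1 * (normc b ^+ 2 * (1 + normc Q) ^+ 2).
    have -> : normc (2^-1 * (z * (b * (1 - Q)) ^+ 2)) =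
        2^-1 * (normc z * (normc b * normc (1 - Q)) ^+ 2).
      by rewrite !expr2 !normcM normcV normcMn normc1.
    rewrite ler_pM2l ?invr_gt0// exprMn mulrA.
    apply: ler_pM; rewrite ?mulr_ge0 ?exprn_ge0 ?normc_ge0//.
      by rewrite ler_piMl// exprn_ge0 ?normc_ge0.
    rewrite lerXn2r ?nnegrE ?addr_ge0 ?normc_ge0//.
    by rewrite (le_trans (le_normcD _ _))// normcN normc1.
  have b0 := normc_ge0 b; have Q0 := normc_ge0 Q.
  apply: le_trans (lerD p_le q_le) _.
  move: (normc b) (normc (1 - b)) (normc Q) b0 Q0 b2 bW Q_le
    => B q1 Q1 B0 Q0 b2 bW Q_le {p_le q_le}.
  (* The exact pair has bound 1. As [Q1 <= e / 4 <= 1 / 8], truncation adds at most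
     [(3/2 + 153/64) Q1 < 4 Q1 <= e] when [Q1 > 0], and nothing when [Q1 = 0]. *)
  have B2 : B ^+ 2 <= 9 / 4 by nra.
  have h1 : B * Q1 <= 3 / 2 * Q1 by rewrite ler_wpM2r.
  have h2 : B ^+ 2 * (2 * Q1 + Q1 ^+ 2) <= 9 / 4 * (2 * Q1 + Q1 ^+ 2).
    by rewrite ler_wpM2r// addr_ge0 ?sqr_ge0// mulr_ge0.
  have h3 : Q1 ^+ 2 <= 1 / 8 * Q1.
    by rewrite expr2 ler_wpM2r//; lra.
  by move: h1 h2 bW; rewrite (_ : B ^+ 2 * (1 + Q1) ^+ 2 =
    B ^+ 2 + B ^+ 2 * (2 * Q1 + Q1 ^+ 2)); [lra|ring].
- by rewrite pE mul0r mulr0.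
- by rewrite qE h0 mulr1 rmorphB rmorph1.
(* [H] is the value of [h] at [r]. Since [(1 + r) e H = 1 - r^(2L) >= 7/8], one has [e H >= 7/16],
   and [r >= 1/2] gives [r (e H)^2 / 2 >= 49/1024 > 1/64]. *)
pose H : R := \sum_(k < L) (r ^+ 2) ^+ k.
have hH : h.[r%:C] = H%:C.
  rewrite hE rmorph_sum; apply: eq_bigr => k _.
  by rewrite -expr2 -!rmorphXn.
have HM : (1 - r ^+ 2) * H = 1 - (r ^+ 2) ^+ L.
  by rewrite -opprB mulNr -subrX1 opprB.
exists (2^-1 * (r * (e * H) ^+ 2)); last first.
  by rewrite -/r pE hH !(rmorphM, rmorphXn)/= fmorphV rmorph_nat.
have : (r ^+ 2) ^+ L <= e / 4.
  rewrite -exprM mulnC exprM expr2 (le_trans _ rL)//.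
  by rewrite ler_piMr ?exprn_ge0 ?exprn_ile1// ltW.
move: HM; set X := (r ^+ 2) ^+ L => HM Xe.
have eH : 7 / 16 <= e * H.
  have : (1 + r) * (e * H) = 1 - X by rewrite -HM /r; ring.
  rewrite /r; nra.
have : (7 / 16) ^+ 2 <= (e * H) ^+ 2 by rewrite lerXn2r ?nnegrE//; lra.
rewrite /r; move: (_ ^+ 2) => Y; nra.
Qed.
End DiscFunctions.

(** * Characters and a single interpolation step *)

Section Characters.
Context {R : realType} {A : uniformAlgebraType R}.
Local Open Scope complex_scope.
Import ComplexField.Normc.
Implicit Types x y : dual A.

Lemma dualD x (f g : A) : x (f + g) = x f + x g.
Proof. exact: linearD. Qed.

Lemma dualZ x (c : R[i]) (f : A) : x (c *: f) = c * x f.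
Proof. exact: linearZ. Qed.

Lemma char_uone x : maximal_ideal_space A x -> x uone = 1.
Proof.
move=> [x0 xM]; have [f xf] : exists f, x f != 0.
  apply: contrapT => /forallNP H; move/eqP: x0; apply.
  apply/val_inj/funext => f.
  by have /negP := H f; rewrite negbK => /eqP.
by apply: (mulIf xf); rewrite -xM umul1 mul1r.
Qed.

Lemma char_uone_neq0 x : maximal_ideal_space A x -> (uone : A) != 0.
Proof.
move=> /char_uone x1; apply/eqP => u0; move: x1; rewrite u0 linear0 => /eqP.
by rewrite eq_sym oner_eq0.
Qed.

Context (nz : (uone : A) != 0).
Local Notation B := (ualg nz).

Lemma charM x (f g : B) : maximal_ideal_space A x -> x (f * g) = x f * x g.
Proof. by move=> [_]; apply. Qed.

Lemma charX x (f : B) n : maximal_ideal_space A x -> x (f ^+ n) = x f ^+ n.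
Proof.
move=> xA; elim: n => [|n IH]; first by rewrite !expr0; exact: char_uone.
by rewrite !exprS -IH; exact: charM.
Qed.

Lemma char_horner x (f : B) (p : {poly R[i]}) :
  maximal_ideal_space A x -> x (horner_alg f p) = p.[x f].
Proof.
move=> xA; elim/poly_ind: p => [|p c IH].
  by rewrite rmorph0 linear0 horner0.
rewrite rmorphD rmorphM/= horner_algX horner_algC !hornerE -IH.
transitivity (x (horner_alg f p * f) + x (c *: uone)); first exact: dualD.
by rewrite charM// dualZ (char_uone _ xA) mulr1.
Qed.

(** All the powers [|x f| ^+ (2 ^ k)] are bounded by the dual norm of [x], which leaves no room for
    [|x f| > 1]. *)
Lemma char_contractive x (f : A) :
  maximal_ideal_space A x -> `|f| <= 1 -> normc (x f) <= 1.
Proof.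
move=> xA f1; apply: (le_of_powers_le _ _ _ (complex.Re (dual_norm x))).
- exact: normc_ge0.
- exact: ler01.
move=> k; rewrite expr1n mulr1.
have xk : normc (x f) ^+ (2 ^ k) <= complex.Re (dual_norm x).
  rewrite -lecR rmorphXn /= -[leLHS]normrX -(charX x (f : B))//.
  exact/dual_norm_ub/ualg_normX_le1.
rewrite (le_trans xk)// ler_peMr ?exprn_ege1// ?ler1n//.
by rewrite (le_trans _ xk)// exprn_ge0// normc_ge0.
Qed.

(** The factor [1 / (1 - e)] in [K] undoes [q.[0] = 1 - e], so values survive where [f] vanishes.
    The threshold 64 matches the lower bound [1/64] for [p.[1 - e]]: it keeps the constant [u],
    which produces the value [a], in the unit ball. *)
Lemma interp_step (e C : R) (f g : B) (a : R[i]) :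
    0 < e -> e <= 2^-1 -> 64 <= C -> `|f| <= 1 -> `|g| <= C%:C -> `|a| <= 1 ->
  exists2 T : B, `|T| <= (C * (1 + 4 * e))%:C &
    forall y, maximal_ideal_space A y ->
      (y f = 0 -> y T = y g) /\
      (y f = (1 - e)%:C -> y g = 0 -> y T = a).
Proof.
move=> e0 e2 C64 f1 gC a1.
have [p [q [pq p0 q0 [c c64 pc]]]] := exists_splitting_polys e e0 e2.
have c0 : 0 < c by apply: lt_le_trans c64; rewrite invr_gt0.
have e1 : 0 < 1 - e by lra.
have C0 : 0 < C by lra.
pose K := C / (1 - e).
have K0 : 0 < K by rewrite divr_gt0.
have CK : C <= K by rewrite ler_pdivlMr// ler_piMr; lra.
have neq0 (r : R) : 0 < r -> r%:C != 0.
  by move=> r0; rewrite -[0]/(0%:C) (inj_eq (@complexI R)) gt_eqF.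
have cn := neq0 c c0; have Cn := neq0 C C0; have Kn := neq0 K K0.
pose u : B := (a / c%:C / K%:C)%:A.
pose g' : B := (C%:C)^-1 *: g.
exists (K%:C *: (horner_alg f p * u + horner_alg f q * g')).
  rewrite normrZ ger0_norm ?ler0c ?(ltW K0)//.
  apply: (@le_trans _ _ (K%:C * (1 + e)%:C)).
    rewrite ler_wpM2l ?ler0c ?(ltW K0)// norm_horner_alg2_le//.
    - rewrite normrZ ualg_norm1 mulr1 !normrM !normfV.
      rewrite (ger0_norm (x := c%:C)) ?ler0c ?(ltW c0)//.
      rewrite (ger0_norm (x := K%:C)) ?ler0c ?(ltW K0)// -mulrA.
      rewrite mulr_ile1// -invfM -rmorphM -fmorphV ?ler0c ?lecR.
        by rewrite invr_ge0 mulr_ge0 ?ltW.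
      have cK : 1 <= c * K by nra.
      by rewrite invf_le1// (lt_le_trans _ cK).
    - rewrite normrZ normfV ger0_norm ?ler0c ?(ltW C0)//.
      by rewrite mulrC ler_pdivrMr ?ltcR// mul1r.
  rewrite -rmorphM lecR /K.
  (* [(1 + e) / (1 - e) <= 1 + 4 e] amounts to [4 e^2 <= 2 e], that is, [e <= 1/2]. *)
  rewrite -mulrA ler_pM2l// ler_pdivrMl//; nra.
move=> y yA.
have yu : y u = a / c%:C / K%:C.
  by rewrite dualZ (char_uone _ yA) mulr1.
have yg' : y g' = (C%:C)^-1 * y g by exact: dualZ.
rewrite dualZ dualD !charM// !char_horner// yu yg'; split=> [->|-> ->].
  by rewrite p0 mul0r add0r q0 !mulrA -rmorphM /K divfK ?gt_eqF// mulfV ?mul1r.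
rewrite pc !mulr0 addr0.
by field; rewrite cn Kn.
Qed.

End Characters.

(** * Finite interpolation from given peak functions *)

Section FiniteInterpolation.
Context {R : realType} {A : uniformAlgebraType R} (nz : (uone : A) != 0).
Local Open Scope complex_scope.
Import ComplexField.Normc.
Local Notation B := (ualg nz).
Context (x : nat -> dual A) (xA : forall n, maximal_ideal_space A (x n)).

(** Induction on [n]. Prescribing 0 outside [[m, n)] makes the previous function vanish at [x n], as
    [interp_step] demands; [f n] vanishes at the other points below [N], so their values are
    kept. *)
Lemma finite_interp (e : nat -> R) (f : nat -> B) (a : nat -> R[i])
    (m N : nat) :
    (forall n, (m <= n < N)%N -> 0 < e n <= 2^-1) ->
    (forall n, (m <= n < N)%N -> [/\ `|f n| <= 1, x n (f n) = (1 - e n)%:C &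
      forall k, (k < N)%N -> k != n -> x k (f n) = 0]) ->
    (forall n, `|a n| <= 1) ->
  forall n, (n <= N)%N ->
  exists2 T : B, `|T| <= (64 * \prod_(m <= k < n) (1 + 4 * e k))%:C &
    forall k, (k < N)%N -> x k T = if (m <= k < n)%N then a k else 0.
Proof.
move=> e01 fP a1; elim=> [|n IH] nN.
  exists 0 => [|k kN]; first by rewrite big_geq// mulr1 normr0 ler0c.
  by rewrite ltn0 andbF; exact: linear0.
have [mn|nm] := leqP m n; last first.
  exists 0 => [|k kN]; first by rewrite big_geq// mulr1 normr0 ler0c.
  rewrite ifF; first exact: linear0.
  by apply/negbTE; rewrite negb_and -leqNgt -ltnNge; lia.
have [g gC gx] := IH (ltnW nN).
have mnN : (m <= n < N)%N by rewrite mn.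
have /andP[e0 e2] := e01 n mnN; have [f1 fn fk] := fP n mnN.
have P1 : 1 <= \prod_(m <= k < n) (1 + 4 * e k).
  rewrite big_nat.
  apply: (big_ind (fun r : R => 1 <= r)) => // [u v|k /andP[mk kn]].
    by move=> u1 v1; nra.
  have /andP[ek _] : 0 < e k <= 2^-1 by apply: e01; rewrite mk (ltn_trans kn).
  by lra.
have [|T TC Tx] := interp_step nz (e n) (64 * \prod_(m <= k < n) (1 + 4 * e k))
  (f n) g (a n) e0 e2 _ f1 gC (a1 n); first by lra.
exists T => [|k kN]; first by rewrite big_nat_recr//= mulrA.
have [kn|kn] := eqVneq k n; have [Tg Ta] := Tx _ (xA k).
  rewrite kn in Tg Ta *; rewrite mn ltnSn; apply: Ta; first exact: fn.
  by rewrite gx// ltnn andbF.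
by rewrite Tg ?fk// gx// ltnS [(k <= n)%N]leq_eqVlt (negbTE kn).
Qed.

(** * The Gleason distance and the construction of peak functions *)

Lemma has_sup_gleason (y z : dual A) : maximal_ideal_space A y ->
  has_sup [set normc (y f) | f in [set f : A | `|f| <= 1 /\ z f = 0]].
Proof.
move=> yA; split.
  by exists (normc (y 0)), 0 => //=; rewrite normr0 ler01 linear0.
by exists 1 => _ /= [f [f1 _] <-]; exact: char_contractive.
Qed.

Lemma gleason_ge0 (y z : dual A) : maximal_ideal_space A y -> 0 <= gleason y z.
Proof.
move=> yA; have [_ ub] := has_sup_gleason y z yA.
apply: (ub_le_sup ub); exists 0; last by rewrite linear0 normc0.
by rewrite /= normr0 ler01 linear0.
Qed.

Lemma gleason_le1 (y z : dual A) : maximal_ideal_space A y -> gleason y z <= 1.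
Proof.
move=> yA; apply: ge_sup; first by have [] := has_sup_gleason y z yA.
by move=> _ [f [f1 _] <-]; exact: char_contractive.
Qed.

(** Multiply, over [k], nearly extremal functions for the distances from [x n] to [x k]. The strict
    inequality allows for suprema that are not attained. *)
Lemma exists_peak_gt (n N : nat) (t : R) : 0 <= t ->
  t < \prod_(0 <= k < N | k != n) gleason (x n) (x k) ->
  exists f : B, [/\ `|f| <= 1, t < normc (x n f) &
    forall k, (k < N)%N -> k != n -> x k f = 0].
Proof.
elim: N t => [|N IH] t t0.
  rewrite big_geq// => t1; exists 1; split; rewrite ?ualg_norm1//.
  by rewrite (char_uone (x n) (xA n)) normc1.
rewrite big_mkcond big_nat_recr//= -big_mkcond /=.
have [Nn|Nn] /= := eqVneq N n.
  rewrite mulr1 => tP; have [f [f1 tf fk]] := IH t t0 tP.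
  exists f; split=> // k kN kn; apply: fk => //.
  by move: kN; rewrite ltnS leq_eqVlt Nn (negbTE kn).
set P := \prod_(_ <= _ < _ | _) _; set r := gleason _ _ => tP.
have r0 : 0 < r.
  rewrite lt0r gleason_ge0// andbT; apply: contraTneq tP => ->.
  by rewrite mulr0 -leNgt.
have [||f [f1 tf fk]] := IH (t / r); rewrite ?divr_ge0 ?(ltW r0) ?ltr_pdivrMr//.
have xf0 : 0 < normc (x n f) by exact: le_lt_trans (divr_ge0 t0 (ltW r0)) tf.
have : t / normc (x n f) < r by rewrite ltr_pdivrMr// mulrC -ltr_pdivrMr.
move=> /sup_gt[]; first by have [] := has_sup_gleason (x n) (x N) (xA n).
move=> _ [g [g1 gN] <-]; rewrite ltr_pdivrMr// => tg.
exists (f * (g : B)); split.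
- by rewrite (le_trans (ualg_normM _ _ _))// mulr_ile1.
- by rewrite charM// normcM mulrC.
move=> k; rewrite ltnS leq_eqVlt charM// => /predU1P[->|kN] kn.
  by rewrite gN mulr0.
by rewrite fk// mul0r.
Qed.

(** Scaling by [t / x n f], of modulus below 1, turns the lower bound into an exact value. *)
Lemma exists_peak (n N : nat) (t : R) : 0 <= t ->
  t < \prod_(0 <= k < N | k != n) gleason (x n) (x k) ->
  exists f : B, [/\ `|f| <= 1, x n f = t%:C &
    forall k, (k < N)%N -> k != n -> x k f = 0].
Proof.
move=> t0 /(exists_peak_gt _ _ _ t0)[f [f1 tf fk]].
have xf0 : 0 < normc (x n f) by exact: le_lt_trans tf.
have xf : x n f != 0.
  by apply: contraTneq xf0 => ->; rewrite normc0 ltxx.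
exists ((t%:C / x n f) *: f); split => [||k kN kn].
- rewrite normrZ mulr_ile1// normrM normfV ger0_norm ?ler0c//.
  rewrite ler_pdivrMr ?normr_gt0// mul1r.
  by rewrite -[leRHS]/((normc (x n f))%:C) lecR ltW.
- by rewrite dualZ divfK.
- by rewrite dualZ (fk k kN kn) mulr0.
Qed.

End FiniteInterpolation.

(** * Interpolation constants independent of the number of points *)

Section UniformBound.
Context {R : realType} {A : uniformAlgebraType R}.
Context (x : nat -> dual A) (xA : forall n, maximal_ideal_space A (x n)).
Local Open Scope complex_scope.
Import ComplexField.Normc.

Let gprod n N : R := \prod_(0 <= k < N | k != n) gleason (x n) (x k).

Lemma gprod_ge0 n N : 0 <= gprod n N.
Proof.
rewrite /gprod; apply: prodr_ge0 => k _.
exact: (gleason_ge0 (char_uone_neq0 _ (xA 0))).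
Qed.

Lemma nonincreasing_gprod n : nonincreasing_seq (gprod n).
Proof.
apply/nonincreasing_seqP => N; rewrite /gprod big_mkcond big_nat_recr//=.
rewrite -big_mkcond /=; case: ifP => _; last by rewrite mulr1.
rewrite ler_piMr//; first exact: gprod_ge0.
exact: (gleason_le1 (char_uone_neq0 _ (xA 0))).
Qed.

Lemma is_cvg_gprod n : cvgn (gprod n).
Proof.
apply: nonincreasing_is_cvgn; first exact: nonincreasing_gprod.
by exists 0 => _ [N _ <-]; exact: gprod_ge0.
Qed.

Lemma delta_le_prod n N :
  delta x n <= \prod_(0 <= k < N | k != n) gleason (x n) (x k).
Proof.
exact: (nonincreasing_cvgn_ge (nonincreasing_gprod n) (is_cvg_gprod n) N).
Qed.

Lemma delta_ge0 n : 0 <= delta x n.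
Proof.
apply: limr_ge; first exact: is_cvg_gprod.
by apply: nearW => N; exact: gprod_ge0.
Qed.

Lemma delta_le1 n : delta x n <= 1.
Proof. by have := delta_le_prod n 0; rewrite big_geq. Qed.

Context (x_sum :
  (\sum_(0 <= n <oo) ((1 - delta x n) `^ (3%:R^-1))%:E < +oo)%E).

(** Each defect lies in [[0, 1]], hence is at most its cube root. *)
Lemma sum_defect_bounded :
  exists S : R, forall N, \sum_(0 <= n < N) (1 - delta x n) <= S.
Proof.
set u := fun n => (1 - delta x n) `^ (3%:R^-1).
have u0 n : (0 <= (u n)%:E)%E by rewrite lee_fin powR_ge0.
have [S SE] : exists S : R, (\sum_(0 <= n <oo) (u n)%:E = S%:E)%E.
  exists (fine (\sum_(0 <= n <oo) (u n)%:E)).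
  by rewrite fineK// ge0_fin_numE// nneseries_ge0.
exists S => N; apply: (@le_trans _ _ (\sum_(0 <= n < N) u n)).
  apply: ler_sum => n _; rewrite /u.
  have : 0 <= 1 - delta x n <= 1 by rewrite subr_ge0 delta_le1 gerBl delta_ge0.
  case/andP; rewrite le_eqVlt => /predU1P[<- _|d0 d1]; first exact: powR_ge0.
  rewrite -[leLHS]powRr1 ?(ltW d0)// ger_powR ?d0 ?d1//; lra.
by rewrite -lee_fin -SE -sumEFin; apply: nneseries_lim_ge => k _ _; exact: u0.
Qed.

Lemma defect_eventually_small :
  exists m, forall n, (m <= n)%N -> 1 - delta x n <= 4^-1.
Proof.
have [S SP] := sum_defect_bounded.
have d0 n : 0 <= 1 - delta x n by rewrite subr_ge0 delta_le1.
have : cvgn (series (fun n => 1 - delta x n)).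
  apply: nondecreasing_is_cvgn.
    by apply/nondecreasing_seqP => N; rewrite /series /= big_nat_recr//= lerDl.
  by exists S => _ [N _ <-]; exact: SP.
move=> /cvg_series_cvg_0 /cvgr0_norm_le /(_ 4^-1) []; first by rewrite invr_gt0.
by move=> m _ mP; exists m => n mn; rewrite (le_trans (ler_norm _))// mP.
Qed.

Context (x_inj : injective x) (nz : (uone : A) != 0).
Local Notation B := (ualg nz).

Lemma exists_separating (n k : nat) : k != n ->
  exists g : B, x n g = 1 /\ x k g = 0.
Proof.
move=> kn; have [f fnk] : exists f : A, x n f - x k f != 0.
  apply: contrapT => /forallNP H; move/negP: kn; apply; apply/eqP/x_inj.
  apply/val_inj/funext => f; apply/eqP; rewrite eq_sym -subr_eq0.
  by have /negP := H f; rewrite negbK.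
exists ((x n f - x k f)^-1 *: (f + (- x k f) *: uone)).
rewrite !dualZ !dualD !dualZ !char_uone// !mulr1 subrr mulr0.
by rewrite mulVf.
Qed.

(** A product of pairwise separating functions. Its norm is uncontrolled, which is harmless because
    only the finitely many [n < m] will be treated this way. *)
Lemma exists_separating_finite (n m : nat) :
  exists g : B, x n g = 1 /\ forall k, (k < m)%N -> k != n -> x k g = 0.
Proof.
elim: m => [|m [g [gn gk]]]; first by exists 1; split=> //; exact: char_uone.
have [mn|mn] := eqVneq m n.
  exists g; split=> // k; rewrite ltnS leq_eqVlt mn => /orP[/eqP -> /eqP //|kn].
  by apply: gk; rewrite mn.
have [h [hn hm]] := exists_separating n m mn.
exists (g * h); split; first by rewrite charM// gn hn mulr1.
move=> k; rewrite ltnS leq_eqVlt => /predU1P[->|km] kn; rewrite charM//.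
  by rewrite hm mulr0.
by rewrite gk// mul0r.
Qed.

Lemma interp_tail : exists m : nat, exists2 C : R, 0 <= C &
  forall (N : nat) (a : nat -> R[i]), (forall n, `|a n| <= 1) ->
  exists2 T : B, `|T| <= C%:C &
    forall k, (k < N)%N -> x k T = if (m <= k)%N then a k else 0.
Proof.
have [S SP] := sum_defect_bounded; have [m mP] := defect_eventually_small.
exists m; exists (64 * expR (4 * (S + 4^-1))).
  by rewrite mulr_ge0 ?expR_ge0.
move=> N a a1.
(* The extra term puts [1 - e n] strictly below [delta x n], as [exists_peak] requires, and makes
   [e n] positive. It is at most [1/8], so [e n <= 1/2] in the tail, and it sums to at most [1/4],
   whence the constant [S + 4^-1]. *)
pose e n := 1 - delta x n + 2^-1 ^+ n / 8.
have d0 n : 0 <= 1 - delta x n by rewrite subr_ge0 delta_le1.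
have e0 n : 0 < e n by rewrite ltr_wpDl// divr_gt0// exprn_gt0.
have e2 n : (m <= n)%N -> e n <= 2^-1.
  move=> /mP dn; have : (2^-1 : R) ^+ n <= 1 by rewrite exprn_ile1//; lra.
  rewrite /e; lra.
have sume : \sum_(m <= k < N) e k <= S + 4^-1.
  have [mN|Nm] := leqP m N; last first.
    rewrite big_geq ?(ltnW Nm)// addr_ge0//.
    by have := SP 0%N; rewrite big_geq.
  apply: (@le_trans _ _ (\sum_(0 <= k < N) e k)).
    rewrite [leRHS](@big_cat_nat _ _ _ m)//= lerDr.
    by apply: sumr_ge0 => k _; exact: ltW.
  rewrite big_split lerD//= -mulr_suml.
  suff : \sum_(0 <= k < N) (2^-1 : R) ^+ k = 2 - 2 * 2^-1 ^+ N.
    have : 0 <= (2^-1 : R) ^+ N by rewrite exprn_ge0.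
    move=> ? ->; lra.
  elim: (N) => [|M IH]; first by rewrite big_geq// expr0; lra.
  by rewrite big_nat_recr//= IH exprS; lra.
have peak n : exists f : B, (m <= n < N)%N ->
    [/\ `|f| <= 1, x n f = (1 - e n)%:C &
      forall k, (k < N)%N -> k != n -> x k f = 0].
  have [mn|mn] := boolP (m <= n < N)%N; last by exists 0.
  have /andP[{}mn nN] := mn.
  have [||f fP] := exists_peak nz x xA n N (1 - e n).
  - by have := e2 n mn; lra.
  - apply: lt_le_trans (delta_le_prod n N); rewrite /e.
    by have : 0 < (2^-1 : R) ^+ n by [rewrite exprn_gt0]; lra.
  by exists f.
have [f fP] := choice peak.
have [|T TC Tx] := finite_interp nz x xA e f a m N _ fP a1 N (leqnn N).
  by move=> n /andP[mn _]; rewrite e0 e2.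
exists T => [|k kN]; last by rewrite Tx// kN andbT.
apply: le_trans TC _; rewrite lecR ler_pM2l//.
apply: (@le_trans _ _ (\prod_(m <= k < N) expR (4 * e k))).
  apply: ler_prod => k _; rewrite expR_ge1Dx andbT addr_ge0// mulr_ge0//.
  exact: ltW.
by rewrite -expR_sum ler_expR -mulr_sumr ler_pM2l.
Qed.

Lemma interp_uniform : exists2 C : R, 0 <= C &
  forall (N : nat) (a : nat -> R[i]), (forall n, `|a n| <= 1) ->
  exists2 T : B, `|T| <= C%:C & forall k, (k < N)%N -> x k T = a k.
Proof.
have [m [C C0 CP]] := interp_tail.
have [g gP] := choice (fun n => exists_separating_finite n m).
pose D : R := \sum_(j < m) (1 + C) * complex.Re `|g j|.
have gE j : `|g j| = (complex.Re `|g j|)%:C by rewrite RRe_real// ger0_real.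
have g0 j : 0 <= complex.Re `|g j| by rewrite -ler0c -gE.
exists (C + D).
  by rewrite addr_ge0// sumr_ge0// => j _; rewrite mulr_ge0// addr_ge0.
move=> N a a1.
have [T TC Tx] := CP N a a1.
have [|U UC Ux] := CP N (fun=> 1); first by move=> _; rewrite normr1.
(* Among the points below [N], [1 - U] is 1 at those of index below [m] and 0 at the others. The sum
   therefore leaves the tail alone and adds the missing values, at a cost of at most [D]. *)
exists (T + \sum_(j < m) a j *: ((1 - U) * g j)).
  rewrite rmorphD (le_trans (ler_normD _ _))// lerD//.
  rewrite rmorph_sum (le_trans (ler_norm_sum _ _ _))//; apply: ler_sum => j _.
  rewrite normrZ -[leRHS]mul1r ler_pM//.
  rewrite rmorphM /= -gE (le_trans (ualg_normM _ _ _))// ler_wpM2r//.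
  by rewrite (le_trans (ler_normB _ _))// ualg_norm1 rmorphD rmorph1 lerD2l.
move=> k kN.
have U1 : x k (1 - U : B) = if (m <= k)%N then 0 else 1.
  transitivity (x k uone - x k U); first exact: linearB.
  by rewrite char_uone// Ux//; case: ifP; rewrite ?subrr ?subr0.
have sumE : x k (\sum_(j < m) a j *: ((1 - U) * g j)) =
    \sum_(j < m) a j * ((if (m <= k)%N then 0 else 1) * x k (g j)).
  transitivity (\sum_(j < m) x k (a j *: ((1 - U) * g j))).
    exact: linear_sum.
  by apply: eq_bigr => j _; rewrite dualZ charM// U1.
rewrite dualD sumE Tx//; case: leqP => [mk|km].
  by rewrite big1 ?addr0// => j _; rewrite mul0r mulr0.
rewrite add0r (bigD1 (Ordinal km))//= big1 ?addr0.
  by rewrite (gP k).1 !mulr1.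
move=> j jk; rewrite (gP j).2 ?mulr0//.
by apply: contraNneq jk => jk; apply/eqP/val_inj.
Qed.

End UniformBound.

(** * Limits in the bidual along an ultrafilter *)

Section BidualLimit.
Context {R : realType} {E : normedModType R[i]}.
Local Open Scope complex_scope.
Import ComplexField.Normc.

Lemma ultra_cvg_real (U : set_system nat) (u : nat -> R) (K : R) :
  UltraFilter U -> (forall n, `|u n| <= K) ->
  exists l : R, u n @[n --> U] --> l.
Proof.
move=> UU uK; have UP : ProperFilter U by exact: ultra_proper.
have [|l [_ ul]] := @segment_compact R (- K) K (u @ U) _.
  have sub : setT `<=` u @^-1` `[(- K), K].
    by move=> n _; rewrite /= in_itv/= -ler_norml.
  exact: filterS sub filterT.
exists l => V lV.
(* Otherwise the ultrafilter contains the complement of the preimage, and [l] would not be a cluster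
   point. *)
have [//|UV] := in_ultra_setVsetC (u @^-1` V) UU.
have uUV : (u @ U) (~` V) by [].
by have [y []] := ul _ _ uUV lV.
Qed.

Lemma ultra_cvg_complex (U : set_system nat) (z : nat -> R[i]^o) (K : R) :
  UltraFilter U -> (forall n, normc (z n) <= K) ->
  exists l : R[i]^o, z n @[n --> U] --> l.
Proof.
move=> UU zK.
have [|a ua] := ultra_cvg_real U (fun n => complex.Re (z n)) K UU.
  move=> n; apply: le_trans (zK n).
  by rewrite -lecR; exact: normc_ge_Re.
have [|b ub] := ultra_cvg_real U (fun n => complex.Im (z n)) K UU.
  move=> n; apply: le_trans (zK n).
  by case: (z n) => c d /=; rewrite -sqrtr_sqr ler_wsqrtr// lerDr sqr_ge0.
exists (a +i* b); apply/cvgrPdist_le => e e0.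
have eE : e = (complex.Re e)%:C by rewrite RRe_real// gtr0_real.
have e2 : 0 < complex.Re e / 2 by rewrite divr_gt0// -ltcR -eE.
move/cvgrPdist_le : ua => /(_ _ e2); move/cvgrPdist_le : ub => /(_ _ e2) ub ua.
near=> n.
have na : `|a - complex.Re (z n)| <= complex.Re e / 2 by near: n.
have nb : `|b - complex.Im (z n)| <= complex.Re e / 2 by near: n.
have -> : (a +i* b) - z n = (a - complex.Re (z n))%:C +
    'i%C * (b - complex.Im (z n))%:C.
  by rewrite [in LHS](complexE (z n)) (complexE (a +i* b))/= !rmorphB/=; ring.
apply: le_trans (ler_normD _ _) _; rewrite normrM.
have normR (r : R) : `|r%:C| = `|r|%:C.
  by rewrite normc_def /= expr0n addr0 sqrtr_sqr.
have -> : `|'i%C : R[i]| = 1.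
  by rewrite normc_def /= expr0n add0r expr1n sqrtr1.
rewrite mul1r !normR eE -rmorphD lecR; lra.
Unshelve. all: by end_near.
Qed.

(* The values [phi (T n)] are bounded, so they converge along an ultrafilter
   finer than [\oo], and the limit is a bounded functional of [phi]. *)
Lemma bidual_limit (T : nat -> E) (C : R) : (forall n, `|T n| <= C%:C) ->
  exists F : bidual E, forall (phi : dual E) (l : R[i]) (N : nat),
    (forall n, (N <= n)%N -> phi (T n) = l) -> F phi = l.
Proof.
move=> TC.
have [U [UU oU]] := @ultraFilterLemma _ \oo _.
have C0 : 0 <= C by rewrite -ler0c (le_trans _ (TC 0%N)).
(* [C] may be 0, so the scaling of [T n] into the unit ball uses [C + 1]. *)
have C1 : 0 < C + 1 by rewrite ltr_wpDl.
have TB (phi : dual E) n : `|phi (T n)| <= (C + 1)%:C * `|phi|.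
  have T1 : `|((C + 1)%:C)^-1 *: T n| <= 1.
    rewrite normrZ normfV ger0_norm ?ler0c ?(ltW C1)//.
    rewrite mulrC ler_pdivrMr ?ltcR//.
    by rewrite mul1r (le_trans (TC n))// lecR lerDl.
  have := dual_norm_ub phi T1; rewrite linearZ /= normrM normfV.
  by rewrite (ger0_norm (x := (C + 1)%:C)) ?ler0c ?(ltW C1)// ler_pdivrMl ?ltcR.
have cvgT (phi : dual E) : exists l : R[i]^o, phi (T n) @[n --> U] --> l.
  apply: (ultra_cvg_complex U _ (complex.Re ((C + 1)%:C * `|phi|)) UU) => n.
  by rewrite -lecR RRe_real ?TB// ger0_real// mulr_ge0// ler0c ltW.
have [F FP] := choice cvgT.
have UP : ProperFilter U by exact: ultra_proper.
have F_linear : linear (F : dual E -> R[i]^o).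
  move=> c phi psi; apply: norm_cvg_unique (FP _) _.
  exact: cvgD (cvgZr (k := c) (FP phi)) (FP psi).
pose Fm := GRing.isLinear.Build R[i] (dual E) R[i]^o *:%R F F_linear.
pose F' : {linear dual E -> R[i]^o} := HB.pack F Fm.
(* Approximating [F phi] by some [phi (T n)] within [|phi|] raises the constant from [C + 1] to
   [C + 2]. *)
have F_bound phi : `|F phi| <= (C + 2)%:C * `|phi|.
  have [->|phi0] := eqVneq phi 0.
    rewrite (_ : F 0 = 0) ?normr0; last exact: (linear0 F').
    by rewrite mulr0.
  have nphi : 0 < `|phi| by rewrite normr_gt0.
  have /cvgrPdist_le /(_ _ nphi) Uphi := FP phi.
  have [n Fn] := filter_ex Uphi.
  rewrite -(subrK (phi (T n)) (F phi)) (le_trans (ler_normD _ _))//.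
  rewrite (_ : C + 2 = 1 + (C + 1)); last by ring.
  by rewrite rmorphD mulrDl rmorph1 mul1r lerD.
have F_cont : continuous (F : dual E -> R[i]^o).
  apply: (bounded_linear_continuous (f := F')); apply/linear_boundedP.
  exists (C + 2)%:C; split; first by rewrite complex_real.
  move=> r Cr phi; apply: le_trans (F_bound phi) _.
  by rewrite ler_wpM2r// ltW.
have FD : (F : dual E -> R[i]^o) \in @dual_pred R (dual E).
  by apply/dual_predP.
exists (Dual FD) => phi l N phil.
apply: norm_cvg_unique (FP phi) _.
apply: cvg_near_cst; apply: oU; exists N => // n; exact: phil.
Qed.

End BidualLimit.

Theorem theorem3p2 (R : realType) (A : uniformAlgebraType R)
    (x : nat -> dual A)
    (x_char : forall n, maximal_ideal_space A (x n))
    (x_inj : injective x)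
    (x_sum : (\sum_(0 <= n <oo) ((1 - delta x n) `^ (3%:R^-1))%:E < +oo)%E) :
  interpolating_bidual x.
Proof.
move=> alpha /pinfty_ex_gt0[K K0 alphaK].
have nz := char_uone_neq0 _ (x_char 0%N).
have [C _ CP] := interp_uniform x x_char x_sum x_inj nz.
have a1 n : `|alpha n / K| <= 1.
  by rewrite normrM normfV (gtr0_norm K0) ler_pdivrMr// mul1r alphaK.
have /choice[T TP] N : exists T : A, `|T| <= (C%:C)%C /\
    forall k, (k < N)%N -> x k T = alpha k / K.
  by have [T TC Tx] := CP N _ a1; exists T.
have KE : K = ((complex.Re K)%:C)%C by rewrite RRe_real// gtr0_real.
have [|F FP] := bidual_limit (fun N => K *: T N) (complex.Re K * C).
  by move=> N; rewrite normrZ rmorphM/= -KE (gtr0_norm K0) ler_pM2l// (TP N).1.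
(* [T N] takes the prescribed value at [x n] as soon as [n < N], so the values are constant from
   [n.+1] on. *)
exists F => n; apply: (FP _ _ n.+1) => N nN.
by rewrite dualZ (TP N).2// mulrC divfK// gt_eqF.
Qed.
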